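(* Let $\tau\geq 2$ be an integer. If $D=(V,A)$ is a digraph whose underlying undirected graph is $\tau$-edge-connected, then $A$ can be decomposed (partitioned) into a $k$-dijoin and a $(\tau-k)$-dijoin of $D$, for every $k\in\{1,\ldots,\tau-1\}$.
   Context: Digraphs are finite and may have parallel arcs. For a digraph $D=(V,A)$ and $U\subseteq V$, $\delta^+(U)$ and $\delta^-(U)$ denote the sets of arcs leaving and entering $U$, respectively. The underlying undirected graph is $\tau$-edge-connected if $|\delta^+(U)|+|\delta^-(U)|\geq\tau$ for all $U\subsetneq V$, $U\neq\emptyset$. A dicut of $D$ is an arc subset of the form $\delta^+(U)$ where $U\subsetneq V$, $U\neq\emptyset$ and $\delta^-(U)=\emptyset$. For an integer $m\geq 1$, an $m$-dijoin of $D$ is a subset of $A$ that intersects every dicut of $D$ in at least $m$ arcs. *)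

(* Defs.v *)
From mathcomp Require Import all_boot.

Set Implicit Arguments.
Unset Strict Implicit.
Unset Printing Implicit Defensive.

(* Arcs form a type of their own, so parallel arcs are distinct arcs with the
   same ends; an arc goes from its tail to its head.  Loops are not excluded:
   a loop neither leaves nor enters any vertex set. *)
Record digraph := Digraph {
  vertex : finType;
  darc : finType;
  tail : darc -> vertex;
  head : darc -> vertex
}.

Definition delta_out (D : digraph) (U : {set vertex D}) : {set darc D} :=
  [set a | (tail a \in U) && (head a \notin U)].

Definition delta_in (D : digraph) (U : {set vertex D}) : {set darc D} :=
  [set a | (tail a \notin U) && (head a \in U)].

Definition edge_connected (D : digraph) (tau : nat) : Prop :=
  forall U : {set vertex D}, U \proper [set: vertex D] -> U != set0 ->
    tau <= #|delta_out U| + #|delta_in U|.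

Definition dicut (D : digraph) (C : {set darc D}) : Prop :=
  exists U : {set vertex D},
    [/\ U \proper [set: vertex D], U != set0, delta_in U = set0
      & C = delta_out U].

Definition dijoin (D : digraph) (m : nat) (J : {set darc D}) : Prop :=
  forall C : {set darc D}, dicut C -> m <= #|J :&: C|.

(* Main.v *)
Require Import Defs.
From mathcomp Require Import all_boot all_order all_algebra.
From mathcomp Require Import zify lra.

(** Exchanging the two parts if necessary, assume [2 * k <= tau].  For an arc
set [J] let [netflow J U] be the number of arcs of [J] leaving [U] minus the
number entering [U]; it is a modular function of [U].  The complement [~: J]
contains at least [tau - k] arcs of the dicut of shore [U] exactly when
[netflow J U <= #|delta_out U| - (tau - k)], and [J] contains at least [k] of
them exactly when [netflow J (~: U) <= - k].  Every net flow also satisfies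
[netflow J W <= #|delta_out W|], and the second condition combined with these
bounds is not crossing submodular.  Both are implied by
[netflow J W <= #|delta_out W| - k] for every nonempty proper [W], which says
that reversing [J] makes the digraph [k]-arc-connected.

The first condition and this one are both given by crossing submodular bounds,
so the question is about vertex weights [y] of total 0 in the intersection of
two crossing base polyhedra.  The net flow of the fraction [k / tau] of every
arc lies in both: it meets the first bound because dicuts have at least [tau]
arcs, and the second because [2 * k <= tau] and the underlying graph is
[tau]-edge-connected.  Two results finish the proof.

- [crossing_intersection_integral]: such an intersection, if nonempty, contains
  an integral vector.  In a fractional vector [y], consider for each of the two
  families the partition of the vertices according to the tight sets that
  contain them.  The weight of every part is an integer
  ([weight_fibre_int]), so no part contains exactly one fractional vertex.
  Each partition therefore has at most half as many parts meeting the
  fractional vertices as there are such vertices, and since the two systems of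
  part-sum equations share the equation for the total, some nonzero direction
  has sum zero on every part of both ([balanced_direction]).  Moving along it
  preserves all tight sets and eventually creates a new one.

- [netflow_exists]: integral weights [y] of total 0 with
  [y(U) <= #|delta_out U|] for all [U] are the net flow of some arc set, by
  induction on the arcs: if an arc can be neither discarded nor selected, then
  two tight sets are separated by it in opposite directions, which contradicts
  submodularity. *)

Set Implicit Arguments.
Unset Strict Implicit.
Unset Printing Implicit Defensive.

Import Order.TTheory GRing.Theory Num.Theory.

(** * Modular weights of vertex sets *)

Section Weight.
Local Open Scope ring_scope.
Variables (R : zmodType) (V : finType).
Implicit Types (y : V -> R) (U W : {set V}).

Definition weight y U : R := \sum_(v in U) y v.

Lemma weight1 y v : weight y [set v] = y v.
Proof. by rewrite /weight big_set1. Qed.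

Lemma weightC y U : weight y (~: U) = weight y setT - weight y U.
Proof.
rewrite /weight [in RHS](bigID [in U]) /= addrC.
rewrite [X in _ + X - _](eq_bigl [in U]) ?addrK; last by move=> v; rewrite inE.
by apply: eq_bigl => v; rewrite !inE.
Qed.

Lemma weightD y U W : W \subset U -> weight y (U :\: W) = weight y U - weight y W.
Proof.
move=> /setIidPr sWU; rewrite /weight [in RHS](big_setID W) /= sWU.
by rewrite addrAC subrr add0r.
Qed.

Lemma weightUI y U W :
  weight y (U :|: W) + weight y (U :&: W) = weight y U + weight y W.
Proof.
have eqD : (U :|: W) :\: U = W :\: (U :&: W).
  by apply/setP => v; rewrite !inE; case: (v \in U); case: (v \in W).
have := congr1 (weight y) eqD; rewrite !weightD ?subsetUl ?subsetIr //.
move/(congr1 (fun z => z + weight y U + weight y (U :&: W))).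
by rewrite subrK => ->; rewrite addrAC subrK addrC.
Qed.
End Weight.

(** * Integrality on the parts cut out by a crossing family *)

Section Crossing.
Local Open Scope ring_scope.
Variable V : finType.
Implicit Types (S T : {set {set V}}) (U W X Z : {set V}) (y : V -> rat).

(** The maximal members are pairwise disjoint and cover the same points, so the
weight of the union is the sum of their weights. *)
Lemma weight_cover_int y S :
  (forall U W, U \in S -> W \in S -> U :&: W != set0 -> U :|: W \in S) ->
  {in S, forall U, weight y U \is a Num.int} ->
  weight y (cover S) \is a Num.int.
Proof.
move=> capS intS; pose M := [set U | maxset [in S] U].
have MS U : U \in M -> U \in S by rewrite inE => /maxsetp.
have trM : trivIset M.
  apply/trivIsetP => U W MU MW; apply: contraR; rewrite -setI_eq0 => UW0.
  have SUW := capS U W (MS U MU) (MS W MW) UW0.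
  move: MU MW; rewrite !inE => /maxsetP[_ maxU] /maxsetP[_ maxW].
  by rewrite -(maxU _ SUW) ?subsetUl // -{2}(maxW _ SUW) ?subsetUr.
have -> : cover S = cover M.
  apply/eqP; rewrite eqEsubset; apply/andP; split; apply/bigcupsP => U.
    move=> SU; have [W maxW sUW] := maxset_exists (P := [in S]) SU.
    by apply: (subset_trans sUW); apply: (bigcup_sup W); rewrite ?inE.
  by move/MS => SU; apply: (bigcup_sup U).
rewrite /weight big_trivIset //=; apply: rpred_sum => U /MS; exact: intS.
Qed.

(** For nested [U] and [W] the conclusion is trivial, so this is the usual notion,
where [U :\: W] and [W :\: U] are assumed nonempty as well. *)
Definition crossing_family S := forall U W, U \in S -> W \in S ->
  U :&: W != set0 -> U :|: W != setT -> (U :&: W \in S) /\ (U :|: W \in S).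

Definition hull T X := \bigcap_(A in T | X \subset A) A.

Lemma sub_hull T X : X \subset hull T X.
Proof. by apply/bigcapsP => A /andP[]. Qed.

(** Two members of [T] that contain the nonempty set [X] intersect; unless they
cover everything, their intersection is again such a member.  The complements
of these members are thus closed under intersecting unions, and the hull is the
complement of their union. *)
Lemma weight_hull_int y T X : crossing_family T ->
  {in T, forall U, weight y U \is a Num.int} -> weight y setT \is a Num.int ->
  X != set0 -> weight y (hull T X) \is a Num.int.
Proof.
move=> crT intT intV Xn0.
have -> : hull T X = ~: cover [set ~: A | A in [set A in T | X \subset A]].
  rewrite /cover big_imset /=; last by move=> A B _ _; apply: setC_inj.
  rewrite setC_bigcup /hull; apply: eq_big => A; rewrite ?inE //.
  by rewrite setCK.
rewrite weightC rpredB //; apply: weight_cover_int.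
  move=> U W /imsetP[A]; rewrite inE => /andP[TA XA] ->{U}.
  move=> /imsetP[B]; rewrite inE => /andP[TB XB] ->{W} AB; rewrite -setCI.
  have sX : X \subset A :&: B by rewrite subsetI XA XB.
  apply: imset_f; rewrite inE sX andbT; apply: (crT A B TA TB _ _).1.
    by apply: contraNneq Xn0 => AB0; rewrite -subset0 -AB0.
  by move: AB; rewrite -setCU; apply: contraNneq => ->; rewrite setCT.
move=> U /imsetP[A]; rewrite inE => /andP[TA _] ->{U}.
by rewrite weightC rpredB // intT.
Qed.

(** Two vertices lie in the same part of the partition generated by [T] when
their signatures agree. *)
Definition signature T v := [set A in T | v \in A].

Lemma mem_hull1 T u v :
  (v \in hull T [set u]) = (signature T u \subset signature T v).
Proof.
apply/bigcapP/subsetP => [uv A | uv A /andP[TA]].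
  by rewrite !inE => /andP[TA uA]; rewrite TA uv // TA sub1set.
by rewrite sub1set => uA; have := uv A; rewrite !inE TA uA => /(_ isT).
Qed.

(** A point outside both hulls is avoided by some [A] containing [X] and some [B]
containing [Z]; these cross or are nested, so that [A :|: B] is a member that
contains [X :|: Z] and avoids the point.  Hence the nonempty hull-closed sets
form an intersecting family. *)
Lemma hullU T X Z : crossing_family T -> X :&: Z != set0 ->
  hull T (X :|: Z) = hull T X :|: hull T Z.
Proof.
move=> crT XZ; apply/eqP; rewrite eqEsubset; apply/andP; split; last first.
  rewrite subUset; apply/andP.
  by split; apply/bigcapsP => A /andP[TA]; rewrite subUset => /andP[XA ZA];
    apply: bigcap_inf; rewrite TA.
apply/subsetP => w; apply: contraLR; rewrite inE negb_or => /andP[].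
move=> /bigcapP wX /bigcapP wZ.
have /existsP[A /and3P[TA XA wA]] : [exists A, [&& A \in T, X \subset A & w \notin A]].
  apply: contra_notT wX => /existsPn nA A /andP[TA XA].
  by have := nA A; rewrite TA XA /= negbK.
have /existsP[B /and3P[TB ZB wB]] : [exists A, [&& A \in T, Z \subset A & w \notin A]].
  apply: contra_notT wZ => /existsPn nA B /andP[TB ZB].
  by have := nA B; rewrite TB ZB /= negbK.
have wAB : w \notin A :|: B by rewrite inE negb_or wA.
apply: contra wAB => /bigcapP; apply; rewrite setUSS // andbT.
apply: (crT A B TA TB _ _).2.
  apply: contraNneq XZ => AB0; rewrite -subset0 -AB0; exact: setISS.
by apply: contraNneq wB => ABT; move: (in_setT w); rewrite -ABT inE (negPf wA).
Qed.

(** The part of [u] is the hull of [u] minus the set [Z] of points with a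
strictly larger signature.  As [Z] contains the hull of each of its points, it
is a union of hull-closed sets, to which [weight_cover_int] applies. *)
Lemma weight_fibre_int y T u : crossing_family T ->
  {in T, forall U, weight y U \is a Num.int} -> weight y setT \is a Num.int ->
  weight y [set v | signature T v == signature T u] \is a Num.int.
Proof.
move=> crT intT intV.
pose Z := [set v | signature T u \proper signature T v].
have -> : [set v | signature T v == signature T u] = hull T [set u] :\: Z.
  apply/setP => v; rewrite !inE mem_hull1 properE eqEsubset andbC.
  by case: (signature T u \subset _); rewrite ?andbF //= negbK andbT.
rewrite weightD; last first.
  by apply/subsetP => v; rewrite inE mem_hull1 => /proper_sub.
apply: rpredB.
  by apply: weight_hull_int => //; rewrite -card_gt0 cards1.
pose S := [set X | [&& X != set0, hull T X == X & X \subset Z]].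
have -> : Z = cover S.
  apply/eqP; rewrite eqEsubset; apply/andP; split; last first.
    by apply/bigcupsP => X; rewrite inE => /and3P[].
  apply/subsetP => v Zv; apply/bigcupP; exists (hull T [set v]); last first.
    by rewrite mem_hull1.
  rewrite inE; apply/and3P; split.
  - by apply/set0Pn; exists v; rewrite mem_hull1.
  - rewrite eqEsubset sub_hull andbT; apply/bigcapsP => A /andP[TA vA].
    by apply: bigcap_inf; rewrite TA /=; apply: bigcap_inf; rewrite TA.
  apply/subsetP => w; rewrite mem_hull1 inE => vw.
  by move: Zv; rewrite inE => uv; apply: proper_sub_trans vw.
apply: weight_cover_int.
  move=> X W; rewrite !inE => /and3P[Xn0 /eqP hX XZ] /and3P[_ /eqP hW WZ] XW.
  rewrite hullU // hX hW eqxx subUset XZ WZ /= andbT.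
  by apply: contraNneq Xn0 => X0; rewrite -subset0 -X0 subsetUl.
move=> X; rewrite inE => /and3P[Xn0 /eqP <- _]; exact: weight_hull_int.
Qed.
End Crossing.

(** * Directions that sum to zero on the parts of two partitions *)

Section BalancedDirection.
Local Open Scope ring_scope.
Variables (R : fieldType) (V : finType).

Lemma homogeneous_solution (s : seq {ffun V -> R}) : (size s < #|V|)%N ->
  exists2 d : V -> R, exists v, d v != 0 &
    forall a, a \in s -> \sum_v a v * d v = 0.
Proof.
move=> lt_sV.
pose M := \matrix_(i < #|V|, j < size s) (tnth (in_tuple s) j) (enum_val i).
have /rowV0Pn[r /sub_kermxP rM r0] : kermx M != 0.
  rewrite kermx_eq0 /row_free neq_ltn (leq_ltn_trans (rank_leq_col M)) //.
exists (fun v => r 0 (enum_rank v)).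
  have /existsP[i ri] : [exists i, r 0 i != 0].
    apply: contraNT r0 => /existsPn r0; apply/eqP/rowP => i; rewrite mxE.
    by apply/eqP; have := r0 i; rewrite negbK.
  by exists (enum_val i); rewrite enum_valK.
move=> a /(tnthP (in_tuple s))[j ->].
transitivity ((r *m M) 0 j); last by rewrite rM mxE.
rewrite mxE (reindex (@enum_val _ V)) /=; last first.
  by apply: onW_bij; exact: enum_val_bij.
by apply: eq_bigr => i _; rewrite mxE enum_valK mulrC.
Qed.

Lemma double_card_imset (K : finType) (f : V -> K) (F : {set V}) :
  (forall u, u \in F -> exists2 v, v \in F & v != u /\ f v = f u) ->
  (2 * #|f @: F| <= #|F|)%N.
Proof.
move=> mate; rewrite -[#|F|]sum1_card (partition_big_imset f) /=.
rewrite mulnC -sum_nat_const; apply: leq_sum => _ /imsetP[u Fu ->].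
have [v Fv [vu fv]] := mate u Fu.
have -> : (2 = #|[set u; v]|)%N by rewrite cards2 eq_sym vu.
rewrite sum1_card; apply/subset_leq_card/subsetP => w.
by case/set2P => ->; rewrite unfold_in /= ?Fu ?Fv ?fv eqxx.
Qed.

(** Counting: outside [F] each vertex imposes one equation [d v = 0]; each of the
two partitions imposes at most [#|F| / 2] further ones.  One of them follows
from the others, as both partitions determine the same total, which brings the
number of equations below the number of unknowns. *)
Lemma balanced_direction (K : finType) (f : bool -> V -> K) (F : {set V}) :
  F != set0 ->
  (forall i u, u \in F -> exists2 v, v \in F & v != u /\ f i v = f i u) ->
  exists d : V -> R, [/\ exists v, d v != 0, forall v, v \notin F -> d v = 0 &
    forall i c, \sum_(v | f i v == c) d v = 0].
Proof.
move=> F0 mate; pose ind (p : pred V) : {ffun V -> R} := [ffun v => (p v)%:R].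
have sum_ind p (d : V -> R) : \sum_v ind p v * d v = \sum_(v | p v) d v.
  rewrite [RHS]big_mkcond; apply: eq_bigr => v _; rewrite ffunE.
  by case: (p v); rewrite ?mul1r ?mul0r.
pose s0 := [seq ind (pred1 w) | w <- enum (~: F)].
pose fibres i := [seq ind [pred v | f i v == c] | c <- enum (f i @: F)].
(* [behead] drops the equation that the total makes redundant. *)
have [|d d0 dP] := @homogeneous_solution (s0 ++ fibres true ++ behead (fibres false)).
  rewrite !size_cat size_behead !size_map -!cardE.
  have := double_card_imset (mate true); have := double_card_imset (mate false).
  have := cardsC F; move: F0; rewrite -card_gt0; lia.
have dF v : v \notin F -> d v = 0.
  move=> vF; have := dP (ind (pred1 v)); rewrite sum_ind big_pred1_eq; apply.
  by rewrite mem_cat map_f // mem_enum inE.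
have sum_out i c : c \notin f i @: F -> \sum_(v | f i v == c) d v = 0.
  move=> cF; apply: big1 => v /eqP fv; apply: dF; apply: contra cF => vF.
  by rewrite -fv imset_f.
have sumt c : \sum_(v | f true v == c) d v = 0.
  have [cF|/sum_out//] := boolP (c \in f true @: F).
  have := dP (ind [pred v | f true v == c]); rewrite sum_ind; apply.
  rewrite !mem_cat; apply/orP; right; apply/orP; left.
  by apply: (map_f (fun c => ind [pred v | f true v == c])); rewrite mem_enum.
have sumV : \sum_v d v = 0.
  rewrite (partition_big (f true) xpredT) //=; apply: big1 => c _; exact: sumt.
exists d; split=> // -[] c //.
have [cF|/sum_out//] := boolP (c \in f false @: F).
have : c \in enum (f false @: F) by rewrite mem_enum.
case def_e: (enum _) => [//|c0 e].
have sume c' : c' \in e -> \sum_(v | f false v == c') d v = 0.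
  move=> ce; have := dP (ind [pred v | f false v == c']); rewrite sum_ind; apply.
  rewrite !mem_cat /fibres def_e /=; apply/orP; right; apply/orP; right.
  exact: (map_f (fun c => ind [pred v | f false v == c])).
rewrite inE => /predU1P[->|/sume//].
have := sumV; rewrite (partition_big (f false) xpredT) //= (bigD1 c0) //=.
rewrite [X in _ + X]big1 ?addr0 // => c' c'0.
have [cF'|/sum_out//] := boolP (c' \in f false @: F).
by apply: sume; move: cF'; rewrite -mem_enum def_e inE (negPf c'0).
Qed.
End BalancedDirection.

(** * Integral points in the intersection of two crossing base polyhedra *)

Section CrossingIntersection.
Local Open Scope ring_scope.
Variable V : finType.
Implicit Types (U W : {set V}) (y : V -> rat).

Definition crossing_submodular (C : {set {set V}}) (b : {set V} -> int) :=
  crossing_family C /\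
  forall U W, U \in C -> W \in C -> U :&: W != set0 -> U :|: W != setT ->
    b (U :&: W) + b (U :|: W) <= b U + b W.

Definition feasible (C : {set {set V}}) (b : {set V} -> int) y :=
  forall U, U \in C -> weight y U <= (b U)%:~R.

Definition tight (C : {set {set V}}) (b : {set V} -> int) y :=
  [set U in C | weight y U == (b U)%:~R].

(** Submodularity of [b] and modularity of the weight leave no slack on the
intersection and the union of two crossing tight sets. *)
Lemma tight_crossing C b y : crossing_submodular C b -> feasible C b y ->
  crossing_family (tight C b y).
Proof.
move=> [crC subb] feas U W; rewrite !inE => /andP[CU /eqP tU] /andP[CW /eqP tW].
move=> UW0 UWT; have [CI CJ] := crC U W CU CW UW0 UWT; rewrite CI CJ /=.
have := subb U W CU CW UW0 UWT; rewrite -(ler_int rat) !rmorphD /=.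
have := weightUI y U W; rewrite tU tW; have := feas _ CI; have := feas _ CJ.
by move=> leJ leI eqUI lesub; split; apply/eqP; lra.
Qed.

(** A part with integral weight cannot have exactly one fractional vertex. *)
Lemma nonint_mate C b y v : crossing_submodular C b -> feasible C b y ->
  weight y setT \is a Num.int -> y v \isn't a Num.int ->
  exists2 w, y w \isn't a Num.int &
    w != v /\ signature (tight C b y) w = signature (tight C b y) v.
Proof.
move=> subb feas intT nv; set T := tight C b y.
have crT : crossing_family T := tight_crossing subb feas.
have intTT : {in T, forall U, weight y U \is a Num.int}.
  by move=> U; rewrite inE => /andP[_ /eqP->]; exact: intr_int.
have /existsP[w /and3P[nw wv /eqP sw]] : [exists w, [&& y w \isn't a Num.int,
    w != v & signature T w == signature T v]].
  apply: contraNT nv => /existsPn nomate.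
  have := weight_fibre_int v crT intTT intT.
  rewrite /weight (bigD1 v) ?inE //= rpredDr //; apply: rpred_sum => w.
  rewrite inE => /andP[sw wv]; have := nomate w.
  by rewrite sw wv !andbT negbK.
by exists w.
Qed.

(** A member of [T] is a union of parts. *)
Lemma sum_signature0 (T : {set {set V}}) (d : V -> rat) U :
  (forall c, \sum_(v | signature T v == c) d v = 0) -> U \in T -> weight d U = 0.
Proof.
move=> d0 TU; rewrite /weight (partition_big (signature T) xpredT) //=.
apply: big1 => c _; have [cU|cU] := boolP (U \in c).
  rewrite -[RHS](d0 c); apply: eq_bigl => v; rewrite andbC.
  by case: eqP => //= sv; move: cU; rewrite -sv inE TU.
apply: big_pred0 => v; apply: contraNF cU => /andP[vU /eqP <-].
by rewrite inE TU.
Qed.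

Lemma weight_shift y (t : rat) d U :
  weight (fun v => y v + t * d v) U = weight y U + t * weight d U.
Proof. by rewrite /weight big_split /= mulr_sumr. Qed.

(** The step length is the least ratio of slack to growth among the sets whose
weight increases; [U0] ensures that there is one. *)
Lemma push_to_tight (C : bool -> {set {set V}}) (b : bool -> {set V} -> int) y d i0 U0 :
  (forall i, feasible (C i) (b i) y) ->
  (forall i U, U \in tight (C i) (b i) y -> weight d U = 0) ->
  U0 \in C i0 -> 0 < weight d U0 ->
  exists t, let y' v := y v + t * d v in
    [/\ forall i, feasible (C i) (b i) y',
        forall i, tight (C i) (b i) y \subset tight (C i) (b i) y' &
        exists i, tight (C i) (b i) y \proper tight (C i) (b i) y'].
Proof.
move=> feas dT CU0 dU0.
pose P := [pred p : bool * {set V} | (p.2 \in C p.1) && (0 < weight d p.2)].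
pose step p := ((b p.1 p.2)%:~R - weight y p.2) / weight d p.2 : rat.
have P0 : P (i0, U0) by rewrite /= CU0.
case: (Order.TotalTheory.arg_minP step P0) => -[j W] /= /andP[CW dW] minW.
set t := step (j, W) in minW; exists t; pose y' v := y v + t * d v; rewrite -/y'.
have t0 : 0 <= t by apply: divr_ge0; [rewrite subr_ge0; exact: feas | exact: ltW].
have sub i : tight (C i) (b i) y \subset tight (C i) (b i) y'.
  apply/subsetP => U TU; have := dT i U TU; move: TU; rewrite !inE.
  by move=> /andP[-> /eqP tU] dU; rewrite weight_shift dU mulr0 addr0 tU /=.
split=> //.
  move=> i U CU; rewrite weight_shift.
  have [dU|dU] := ltP 0 (weight d U).
    have := minW (i, U); rewrite /= CU dU => /(_ isT).
    by rewrite ler_pdivlMr //= => le; lra.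
  have := feas i U CU; have := mulr_ge0_le0 t0 dU; lra.
exists j; rewrite properE sub; apply/subsetPn; exists W.
  have dWn0 : weight d W != 0 by rewrite gt_eqF.
  by rewrite inE CW weight_shift /t /step /= divfK // addrC subrK /=.
by apply/negP => /dT dW0; move: dW; rewrite dW0 ltxx.
Qed.

(** Induction on the number of slack constraints.  The singletons bound every
coordinate from above, and a nonzero direction of total 0 has a positive
coordinate, so each move is stopped by a new tight set. *)
Theorem crossing_intersection_integral
    (C : bool -> {set {set V}}) (b : bool -> {set V} -> int) y :
  (forall i, crossing_submodular (C i) (b i)) ->
  (forall v, [set v] \in C true) ->
  (forall i, feasible (C i) (b i) y) ->
  weight y setT \is a Num.int ->
  exists z : V -> int, (forall i U, U \in C i -> weight z U <= b i U) /\
    (weight z setT)%:~R = weight y setT.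
Proof.
move=> subb C1; pose slack y := (\sum_i #|C i :\: tight (C i) (b i) y|)%N.
have [n] := ubnP (slack y); elim: n y => // n IHn y lt_slack feas intT.
pose F := [set v | y v \isn't a Num.int].
have [F0|F0] := eqVneq F set0.
  have inty v : (Num.floor (y v))%:~R = y v.
    apply/eqP; rewrite -intrEfloor; move/setP: F0 => /(_ v).
    by rewrite !inE => /negbFE.
  have intw U : (weight (fun v => Num.floor (y v)) U)%:~R = weight y U.
    by rewrite /weight rmorph_sum; apply: eq_bigr => v _; exact: inty.
  exists (fun v => Num.floor (y v)); split=> // i U CU.
  by rewrite -(ler_int rat) intw feas.
have [|d [[v dv] _ dfib]] := @balanced_direction rat _ _
    (fun i => signature (tight (C i) (b i) y)) F F0.
  move=> i u; rewrite inE => nu.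
  have [w nw sw] := nonint_mate (subb i) (feas i) intT nu.
  by exists w => //; rewrite inE.
have dT i U : U \in tight (C i) (b i) y -> weight d U = 0.
  exact: sum_signature0.
have dV : weight d setT = 0.
  rewrite /weight (partition_big (signature (tight (C true) (b true) y)) xpredT) //=.
  apply: big1 => c _; rewrite -[RHS](dfib true c); apply: eq_bigl => w.
  by rewrite inE.
have /existsP[w dw] : [exists w, 0 < d w].
  apply: contraNT dv => /existsPn dneg.
  have dle w : d w <= 0 by rewrite leNgt.
  have := dV; rewrite /weight (bigD1 v) ?inE //= => dv0.
  rewrite eq_le dle /=.
  have : \sum_(i in setT | i != v) d i <= 0 by apply: sumr_le0.
  lra.
have [|t [feas' sub [j prop]]] := push_to_tight feas dT (C1 w).
  by rewrite weight1.
have [||z [zC zT]] := IHn _ _ feas'.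
- rewrite -ltnS; apply: leq_trans lt_slack; rewrite ltnS /slack.
  rewrite (bigD1 j) // [ltnRHS](bigD1 j) //= -addSn leq_add //.
    apply: proper_card; rewrite properE setDS ?sub //=.
    have /properP[_ [U TU nTU]] := prop.
    apply/subsetPn; exists U; rewrite inE ?TU ?nTU //.
    by move: TU; rewrite inE => /andP[].
  by apply: leq_sum => i _; apply/subset_leq_card/setDS.
- by rewrite weight_shift dV mulr0 addr0.
by exists z; split=> //; rewrite zT weight_shift dV mulr0 addr0.
Qed.
End CrossingIntersection.

(** * Vertex weights that are net flows of arc sets *)

Section ArcSets.
Local Open Scope ring_scope.
Variable D : digraph.
Implicit Types (A J : {set darc D}) (U W : {set vertex D}).

Lemma card_setI_sum A (B : {set darc D}) :
  #|A :&: B| = (\sum_(a in A) (a \in B))%N.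
Proof.
rewrite -sum1_card (eq_bigl (fun a => (a \in A) && (a \in B))); last first.
  by move=> a; rewrite inE.
by rewrite big_mkcondr; apply: eq_bigr => a _; case: (a \in B).
Qed.

Lemma delta_out_submodular A U W :
  (#|A :&: delta_out (U :&: W)| + #|A :&: delta_out (U :|: W)| <=
   #|A :&: delta_out U| + #|A :&: delta_out W|)%N.
Proof.
rewrite !card_setI_sum -!big_split /=; apply: leq_sum => a _; rewrite !inE.
by do 4!case: (_ \in _).
Qed.

Lemma delta_outC U : delta_out (~: U) = delta_in U.
Proof. by apply/setP => a; rewrite !inE negbK. Qed.

Lemma delta_inC U : delta_in (~: U) = delta_out U.
Proof. by apply/setP => a; rewrite !inE negbK. Qed.

Definition netflow J U : int := #|J :&: delta_out U|%:Z - #|J :&: delta_in U|%:Z.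

Lemma cardsD1I (a : darc D) A (B : {set darc D}) : a \in A ->
  #|A :&: B| = ((a \in B) + #|(A :\ a) :&: B|)%N.
Proof. by move=> Aa; rewrite (cardsD1 a) inE Aa setIDAC. Qed.

Lemma weight_indicator (t : vertex D) U :
  weight (fun v => (v == t)%:Z) U = (t \in U)%:Z.
Proof.
rewrite /weight big_mkcond (bigD1 t) //= eqxx big1 ?addr0 => [|v /negPf->].
  by case: (t \in U).
by case: ifP.
Qed.

Definition excess J v : int :=
  \sum_(a in J) ((v == tail a)%:Z - (v == Defs.head a)%:Z).

Lemma weight_excess J U : weight (excess J) U = netflow J U.
Proof.
rewrite /netflow !card_setI_sum !(big_morph Posz PoszD (erefl _)) -sumrB.
rewrite /weight exchange_big /=; apply: eq_bigr => a _.
rewrite sumrB; have := weight_indicator (tail a) U.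
have := weight_indicator (Defs.head a) U; rewrite /weight => -> ->; rewrite !inE.
by do 2!case: (_ \in _).
Qed.

(** Pick an arc [a].  If it cannot be left out, some [U0] is violated without it;
then [a] leaves [U0] and [U0] is tight.  Selecting [a] lowers the demand at its
tail by one and raises it at its head by one.  A set [W] violated after that
would be entered by [a] and tight, and then [a], which joins [U0 :\: W] to
[W :\: U0], makes the submodular inequality for [U0] and [W] strict. *)
Lemma netflow_exists A (y : vertex D -> int) :
  weight y setT = 0 -> (forall U, weight y U <= #|A :&: delta_out U|%:Z) ->
  exists2 J : {set darc D}, J \subset A & forall U, netflow J U = weight y U.
Proof.
have [n] := ubnP #|A|; elim: n A y => // n IHn A y ltAn y0 leyA.
have [A0|[a Aa]] := set_0Vmem A.
  exists set0; rewrite ?sub0set // => U; rewrite /netflow !set0I cards0.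
  have := leyA U; have := leyA (~: U); rewrite weightC y0 A0 !set0I cards0; lia.
have ltA1 : (#|A :\ a| < n)%N by move: ltAn; rewrite (cardsD1 a) Aa.
have [/forallP leA1|/forallPn[U0]] :=
    boolP [forall U, weight y U <= #|(A :\ a) :&: delta_out U|%:Z].
  have [J JA JP] := IHn _ y ltA1 y0 leA1.
  by exists J => //; apply: subset_trans JA (subsetDl _ _).
rewrite -ltNge => gtU0.
pose y' v := y v - (v == tail a)%:Z + (v == Defs.head a)%:Z.
have wy' U : weight y' U = weight y U - (tail a \in U)%:Z + (Defs.head a \in U)%:Z.
  rewrite -!weight_indicator /weight -sumrB -big_split /=.
  by apply: eq_bigr.
have cardA U : #|A :&: delta_out U| =
    ((tail a \in U) && (Defs.head a \notin U) + #|(A :\ a) :&: delta_out U|)%N.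
  by rewrite (cardsD1I _ Aa) inE.
have [||J JA JP] := IHn _ y' ltA1.
- by rewrite wy' y0 !inE.
- move=> W; rewrite wy'.
  have := delta_out_submodular (A :\ a) U0 W; have := weightUI y U0 W.
  have := leyA (U0 :&: W); have := leyA (U0 :|: W); have := leyA U0.
  have := leyA W.
  move: gtU0; rewrite !cardA !inE.
  by do ?case: (_ \in _) => /=; lia.
exists (a |: J).
  by rewrite subUset sub1set Aa; apply: subset_trans JA (subsetDl _ _).
have aJ : a \notin J by apply/negP => /(subsetP JA); rewrite !inE eqxx.
move=> U; have := JP U; rewrite wy' /netflow.
rewrite !(@cardsD1I a (a |: J)) ?setU11 // setU1K // !inE.
by do 2!case: (_ \in _) => /=; lia.
Qed.
End ArcSets.

(** * Splitting the arcs into two dijoins *)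

Section MainTheorem.
Local Open Scope ring_scope.

(** The bound [k + k <= tau] is what makes the net flow of the fraction
[r = k / tau] of every arc at most [#|delta_out U| - k] on every nonempty proper
set [U]: the slack is at least [(1 - 2 * r) * #|delta_out U|]. *)
Lemma dijoin_pair_le_half (tau k : nat) (D : digraph) :
  edge_connected D tau -> (0 < k)%N -> (k + k <= tau)%N ->
  exists J : {set darc D}, dijoin k J /\ dijoin (tau - k) (~: J).
Proof.
move=> hD k0 k2.
(* A digraph with at most one vertex has no dicut. *)
have [V1|V2] := leqP #|vertex D| 1.
  exists set0; split=> X [U [UT U0 _ _]].
    have := proper_card UT; move: U0; rewrite -card_gt0 cardsT; lia.
  have := proper_card UT; move: U0; rewrite -card_gt0 cardsT; lia.
(* Index [true] is the demand that reversing [J] gives a [k]-arc-connected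
   digraph, index [false] the demand that [~: J] is a [tau - k]-dijoin. *)
pose nontriv := [set U : {set vertex D} | (U != set0) && (U != setT)].
pose C (i : bool) := if i then nontriv else [set U in nontriv | delta_in U == set0].
pose b (i : bool) (U : {set vertex D}) : int :=
  #|delta_out U|%:Z - (if i then k else tau - k)%N%:Z.
pose r : rat := k%:Q / tau%:Q.
have tau0 : 0 < tau%:Q :> rat by rewrite ltr0n; lia.
pose y (v : vertex D) : rat := r * (excess [set: darc D] v)%:~R.
have wy U : weight y U = r * (#|delta_out U|%:Q - #|delta_in U|%:Q).
  rewrite /weight -mulr_sumr -rmorph_sum /= -/(weight _ U) weight_excess.
  by rewrite /netflow !setTI rmorphB.
have yV : weight y setT = 0.
  have -> : setT = ~: set0 :> {set vertex D} by rewrite setC0.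
  rewrite wy delta_outC delta_inC.
  have -> : delta_in set0 = set0 :> {set darc D} by apply/setP => a; rewrite !inE andbF.
  have -> : delta_out set0 = set0 :> {set darc D} by apply/setP => a; rewrite !inE.
  by rewrite cards0 subrr mulr0.
have rtau : r * tau%:Q = k%:Q by rewrite /r divfK // gt_eqF.
have r0 : 0 <= r by rewrite divr_ge0 // ler0n.
have r2 : 2 * r <= 1.
  rewrite /r mulrA ler_pdivrMr // mul1r -[2]/(2%:Q) -intrM ler_int; lia.
have crossC i : crossing_family (C i).
  move=> U W CU CW UW0 UWT; have ntU : U \in nontriv.
    by case: i CU {CW} => //; rewrite inE => /andP[].
  have ntI : U :&: W \in nontriv.
    rewrite inE UW0; move: ntU; rewrite inE => /andP[_].
    by apply: contraNneq => IT; rewrite -subTset -IT subsetIl.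
  have ntJ : U :|: W \in nontriv.
    rewrite inE UWT andbT; move: ntU; rewrite inE => /andP[+ _].
    by apply: contraNneq => J0; rewrite -subset0 -J0 subsetUl.
  case: i CU CW => // CU CW; move: CU CW; rewrite /C !inE.
  move=> /andP[_ /eqP/setP inU] /andP[_ /eqP/setP inW].
  move: ntI ntJ; rewrite !inE => -> -> /=.
  by split; apply/eqP/setP => a; have := inU a; have := inW a; rewrite !inE;
    do 4!case: (_ \in _).
have subb i : crossing_submodular (C i) (b i).
  split=> // U W _ _ _ _; have := delta_out_submodular setT U W.
  rewrite !setTI /b; lia.
have conn U : U \in nontriv -> (tau <= #|delta_out U| + #|delta_in U|)%N.
  by rewrite inE => /andP[U0 UT]; apply: hD => //; rewrite properT.
have feas i : feasible (C i) (b i) y.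
  move=> U CU; rewrite wy; case: i CU => CU.
    have leconn : tau%:Q <= #|delta_out U|%:Q + #|delta_in U|%:Q.
      by rewrite -intrD ler_int; have := conn U CU; lia.
    have out0 : 0 <= #|delta_out U|%:Q by rewrite ler0n.
    have := ler_wpM2l r0 leconn; have := ler_wpM2r out0 r2.
    rewrite rtau /b rmorphB /=; lra.
  move: CU; rewrite inE => /andP[ntU /eqP in0]; have := conn U ntU.
  rewrite /b in0 cards0 addn0 => leout.
  have {}leout : tau%:Q <= #|delta_out U|%:Q by rewrite ler_int.
  have -> : (#|delta_out U|%:Z - (tau - k)%N%:Z)%:~R =
      #|delta_out U|%:Q - tau%:Q + k%:Q.
    by rewrite -rmorphB -rmorphD; congr (_%:~R); lia.
  have r1' : 0 <= 1 - r by lra.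
  have := ler_wpM2l r1' leout.
  lra.
have C1 v : [set v] \in C true.
  rewrite inE -card_gt0 cards1 /=; apply: contraTneq V2 => vT.
  by rewrite -cardsT -vT cards1.
have [|z [zC zT]] := crossing_intersection_integral subb C1 feas.
  by rewrite yV.
have {}zT : weight z setT = 0 by apply/eqP; rewrite -(intr_eq0 rat) zT yV.
have [|J _ JP] := @netflow_exists D setT z zT.
  move=> U; rewrite setTI; have [->|U0] := eqVneq U set0.
    by rewrite /weight big_set0.
  have [->|UT] := eqVneq U setT; first by rewrite zT.
  have := zC true U; rewrite inE U0 UT /b => /(_ isT); lia.
exists J; split=> X [U [UT U0 in0 ->{X}]]; rewrite properT in UT.
  (* No arc leaves [~: U], so at least [k] arcs of [J] leave [U]. *)
  have CU0 : ~: U != set0 by rewrite -setCT (inj_eq (@setC_inj _)).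
  have CUT : ~: U != setT by rewrite -setC0 (inj_eq (@setC_inj _)).
  have := zC true (~: U); rewrite inE CU0 CUT => /(_ isT).
  rewrite /b delta_outC in0 cards0 weightC zT -JP /netflow in0 setI0 cards0; lia.
have := zC false U; rewrite !inE U0 UT in0 eqxx => /(_ isT).
rewrite /b -JP /netflow in0 setI0 cards0.
have := cardsID J (delta_out U); rewrite setDE [~: J :&: _]setIC [J :&: _]setIC; lia.
Qed.
End MainTheorem.

Theorem theorem17 (tau : nat) (htau : 2 <= tau) (D : digraph)
    (hD : edge_connected D tau) (k : nat) (hk : 1 <= k <= tau - 1) :
  exists J1 J2 : {set darc D},
    [/\ J1 :|: J2 = [set: darc D], [disjoint J1 & J2],
        dijoin k J1 & dijoin (tau - k) J2].
Proof.
have [k0 kt] := andP hk.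
have [k2|k2] := leqP (k + k) tau.
  have [J [J1 J2]] := dijoin_pair_le_half hD k0 k2.
  by exists J, (~: J); split; rewrite ?setUCr // -setI_eq0 setICr.
have [||J [J1 J2]] := @dijoin_pair_le_half tau (tau - k) D hD; try lia.
rewrite subKn in J2; last by lia.
by exists (~: J), J; split; rewrite 1?setUC ?setUCr // -setI_eq0 setIC setICr.
Qed.
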